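(* Let $p,q,q'\in[1,\infty]$ with $q'\leq q$, let $\lambda,\mu\in\mathbb{F}$, let $E_0,E,L,L_0$ be locally convex spaces, and let $Q\in\mathcal{L}(E_0,E)$, $T,S\in\mathcal{L}(E,L)$ and $R\in\mathcal{L}(L,L_0)$. Then: (i) if $T$ and $S$ are weakly $(p,q)$-convergent, then so are $R\circ T\circ Q$ and $\lambda T+\mu S$; (ii) if $T$ and $S$ are weak$^\ast$ $(p,q)$-convergent, then so are $R\circ T\circ Q$ and $\lambda T+\mu S$; (iii) (for $p\le q$) if $T$ and $S$ are $(p,q)$-limited operators, then so are $R\circ T\circ Q$ and $\lambda T+\mu S$; (iv) (for $p\le q$) if $T$ and $S$ are $(p,q)$-$(V^\ast)$ operators, then so are $R\circ T\circ Q$ and $\lambda T+\mu S$; (v) if $T$ and $S$ are $(q',q)$-limited $p$-convergent, then so are $R\circ T\circ Q$ and $\lambda T+\mu S$; (vi) if $T$ and $S$ are $(q',q)$-$(V^\ast)$ $p$-convergent, then so are $R\circ T\circ Q$ and $\lambda T+\mu S$; (vii) if $T$ and $S$ are coarse $p$-limited, then so are $R\circ T\circ Q$ and $\lambda T+\mu S$.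
   Context: All locally convex spaces are Hausdorff and over the field $\mathbb{F}\in\{\mathbb{R},\mathbb{C}\}$. $\mathcal{L}(H,L)$ is the set of continuous linear maps (operators) from $H$ to $L$. $E'$ is the topological dual of $E$; $E'_\beta$ is $E'$ with the strong topology $\beta(E',E)$. A sequence $\{x_n\}$ in a locally convex space $E$ is weakly $p$-summable if for every $\chi\in E'$, $(\langle\chi,x_n\rangle)_n\in\ell_p$ if $p<\infty$, and $(\langle\chi,x_n\rangle)_n\in c_0$ if $p=\infty$. A sequence $\{\chi_n\}$ in $E'$ is weak$^\ast$ $p$-summable if for every $x\in E$, $(\langle\chi_n,x\rangle)_n\in\ell_p$ (in $c_0$ if $p=\infty$). For $1\le r\le s\le\infty$, a non-empty $A\subseteq E$ is an $(r,s)$-limited set (resp., an $(r,s)$-$(V^\ast)$ set) if $\big(\sup_{a\in A}|\langle\chi_n,a\rangle|\big)_n$ belongs to $\ell_s$ (to $c_0$ if $s=\infty$) for every weak$^\ast$ $r$-summable sequence $\{\chi_n\}$ in $E'$ (resp., every weakly $r$-summable sequence $\{\chi_n\}$ in the locally convex space $E'_\beta$). A non-empty $A\subseteq E$ is coarse $p$-limited if for every $S\in\mathcal{L}(E,\ell_p)$ (or $S\in\mathcal{L}(E,c_0)$ if $p=\infty$) the set $S(A)$ is relatively compact. A linear map $T:E\to L$ is: weakly (resp., weak$^\ast$) $(p,q)$-convergent if $\lim_n\langle\eta_n,T(x_n)\rangle=0$ for every weakly $q$-summable sequence $\{\eta_n\}$ in $L'_\beta$ (resp., weak$^\ast$ $q$-summable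 sequence $\{\eta_n\}$ in $L'$) and every weakly $p$-summable sequence $\{x_n\}$ in $E$; $(p,q)$-limited (resp., $(p,q)$-$(V^\ast)$, coarse $p$-limited) if $T(U)$ is a $(p,q)$-limited (resp., $(p,q)$-$(V^\ast)$, coarse $p$-limited) subset of $L$ for some neighborhood $U$ of zero in $E$; $(q',q)$-limited $p$-convergent (resp., $(q',q)$-$(V^\ast)$ $p$-convergent) if $T(x_n)\to0$ for every weakly $p$-summable sequence $\{x_n\}$ in $E$ which is a $(q',q)$-limited (resp., $(q',q)$-$(V^\ast)$) subset of $E$. *)

(* Defs.v *)
From HB Require Import structures.
From mathcomp Require Import all_boot all_order all_algebra.
From mathcomp Require Import complex.
From mathcomp Require Import all_classical all_reals all_analysis.

Set Implicit Arguments.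
Unset Strict Implicit.
Unset Printing Implicit Defensive.
Import Order.TTheory GRing.Theory Num.Def Num.Theory.
Import numFieldNormedType.Exports.

Local Open Scope classical_set_scope.
Local Open Scope ring_scope.

Inductive scalar_kind := RealScalars | ComplexScalars.

Definition scalars (R : realType) (k : scalar_kind) : numFieldType :=
  match k with
  | RealScalars => R
  | ComplexScalars => (complex R : numFieldType)
  end.

(* The norm of an element of [complex R] takes its values in [complex R];
   [modulus] is the norm as an element of [R]. *)
Definition modulus (R : realType) (k : scalar_kind) : scalars R k -> R :=
  match k with
  | RealScalars => fun x => `|x|
  | ComplexScalars => @Normc.normc R
  end.

Definition of_real (R : realType) (k : scalar_kind) : R -> scalars R k :=
  match k with
  | RealScalars => id
  | ComplexScalars => fun x => real_complex R x
  end.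

Section scalars_theory.
Context (R : realType) (k : scalar_kind).
Implicit Types (x y : scalars R k) (a b : R).

Lemma normE x : `|x| = of_real k (modulus x).
Proof. by case: k x. Qed.

Lemma of_realD a b : of_real k (a + b) = of_real k a + of_real k b.
Proof. by case: k => //=; rewrite rmorphD. Qed.

Lemma of_realM a b : of_real k (a * b) = of_real k a * of_real k b.
Proof. by case: k => //=; rewrite rmorphM. Qed.

Lemma ler_of_real a b : (of_real k a <= of_real k b) = (a <= b).
Proof. by case: k => //=; rewrite lecR. Qed.

Lemma of_real_inj : injective (of_real k : R -> scalars R k).
Proof. by case: k => //= a b []. Qed.

Lemma of_real0 : of_real k 0 = 0 :> scalars R k.
Proof. by case: k. Qed.

Lemma modulus0 : modulus (0 : scalars R k) = 0.
Proof. by apply: of_real_inj; rewrite -normE normr0 of_real0. Qed.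

Lemma modulus_ge0 x : 0 <= modulus x.
Proof. by rewrite -ler_of_real -normE of_real0. Qed.

Lemma modulusD x y : modulus (x + y) <= modulus x + modulus y.
Proof. by rewrite -ler_of_real of_realD -!normE ler_normD. Qed.

Lemma modulusM x y : modulus (x * y) = modulus x * modulus y.
Proof. by apply: of_real_inj; rewrite of_realM -!normE normrM. Qed.

Lemma modulus_eq0 x : modulus x = 0 -> x = 0.
Proof. by move=> x0; apply/normr0_eq0; rewrite normE x0 of_real0. Qed.

End scalars_theory.

HB.structure Definition ContinuousLinear (K : numFieldType) (E L : tvsType K) :=
  {f of @GRing.Linear K E L *:%R f & @Continuous E L f}.

Notation "''L' ( E , L )" := (ContinuousLinear.type E L)
  (at level 8, format "''L' ( E ,  L )") : type_scope.

Section continuous_linear.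
Context (K : numFieldType) (E L : tvsType K).

Definition continuous_linear : {pred E -> L} :=
  mem [set f | linear f /\ continuous f].

Section Sub.
Context (f : E -> L) (fP : f \in continuous_linear).
#[local] HB.instance Definition _ :=
  @GRing.isLinear.Build K E L *:%R f (set_mem fP).1.
#[local] HB.instance Definition _ := @isContinuous.Build E L f (set_mem fP).2.
Definition continuous_linear_Sub : 'L(E, L) := f.
End Sub.

Lemma continuous_linear_rect (P : 'L(E, L) -> Type) :
  (forall f (Pf : f \in continuous_linear), P (continuous_linear_Sub Pf)) ->
  forall u, P u.
Proof.
move=> PSub f.
have Pf : (f : E -> L) \in continuous_linear.
  by rewrite inE; split; [exact: linearP|exact: cts_fun].
suff -> : f = continuous_linear_Sub Pf by exact: PSub.
case: f Pf => f [c1 c2 c3] Pf; rewrite /continuous_linear_Sub.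
have e1 (a b : GRing.MathCompCompatAdditive.Additive.mixin_of E L f) : a = b.
  by case: a b => [a] [b]; f_equal; exact: Prop_irrelevance.
have e2 (a b : GRing.isScalable.axioms_ K E L *:%R f) : a = b.
  by case: a b => [a] [b]; f_equal; exact: Prop_irrelevance.
have e3 (a b : isContinuous.axioms_ E L f) : a = b.
  by case: a b => [a] [b]; f_equal; exact: Prop_irrelevance.
congr ContinuousLinear.Pack; congr ContinuousLinear.Class;
  [exact: e1|exact: e2|exact: e3].
Qed.

Lemma continuous_linear_valP f (Pf : f \in continuous_linear) :
  continuous_linear_Sub Pf = f :> (E -> L).
Proof. by []. Qed.

HB.instance Definition _ :=
  isSub.Build _ _ 'L(E, L) continuous_linear_rect continuous_linear_valP.
HB.instance Definition _ := [Choice of 'L(E, L) by <:].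

Lemma continuous_linear_submod_closed : submod_closed continuous_linear.
Proof.
split.
  rewrite inE; split; first by move=> a x y /=; rewrite scaler0 addr0.
  exact: cst_continuous.
move=> a f g; rewrite !inE => -[lf cf] [lg cg]; split.
  move=> b x y; rewrite /= !fctE.
  rewrite lf lg !scalerDr !scalerA [a * b]mulrC -!addrA; congr (_ + _).
  by rewrite addrCA.
move=> x; apply: (@continuous_comp E (L * L)%type L
  (fun y => (a *: f y, g y)) (fun z => z.1 + z.2)); last exact: add_continuous.
apply: cvg_pair; last exact: cg.
apply: (@continuous_comp E (K^o * L)%type L
  (fun y => (a, f y)) (fun z => z.1 *: z.2)); last exact: scale_continuous.
by apply: (@cvg_pair _ _ _ _ (nbhs (a : K^o))); [exact: cvg_cst|exact: cf].
Qed.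

HB.instance Definition _ := GRing.isSubmodClosed.Build _ _ continuous_linear
  continuous_linear_submod_closed.
HB.instance Definition _ := [SubChoice_isSubLmodule of 'L(E, L) by <:].

End continuous_linear.

Definition dual (K : numFieldType) (E : tvsType K) := 'L(E, K^o).

Definition tvs_bounded (K : numFieldType) (E : tvsType K) (B : set E) :=
  forall U, nbhs (0 : E) U ->
    exists2 r : K, 0 < r & forall t : K, r <= `|t| -> B `<=` *:%R t @` U.

Definition strong_dual (K : numFieldType) (E : tvsType K) : Type := 'L(E, K^o).

Section strong_dual.
Context (K : numFieldType) (E : tvsType K).
Local Notation T := (strong_dual E).
Implicit Types (B : set E) (e r : K) (chi psi : T).

HB.instance Definition _ := GRing.Lmodule.on T.

Local Notation ev := (fun chi : T => ((chi : 'L(E, K^o)) : E -> K)).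

(* The topology of uniform convergence on the bounded subsets of [E]. *)
Definition strong_ball chi B e : set T :=
  [set psi | forall x, B x -> `|ev psi x - ev chi x| < e].

Definition strong_nbhs chi : set_system T :=
  filter_from [set Be : set E * K | tvs_bounded Be.1 /\ 0 < Be.2]
    (fun Be => strong_ball chi Be.1 Be.2).

HB.instance Definition _ := hasNbhs.Build T strong_nbhs.

Lemma tvs_bounded0 : tvs_bounded (set0 : set E).
Proof. by move=> U _; exists 1 => // t _ x. Qed.

Lemma tvs_boundedU B1 B2 :
  tvs_bounded B1 -> tvs_bounded B2 -> tvs_bounded (B1 `|` B2).
Proof.
move=> b1 b2 U U0.
have [r1 r10 h1] := b1 _ U0; have [r2 r20 h2] := b2 _ U0.
exists (r1 + r2); first exact: addr_gt0.
move=> t rt; rewrite subUset; split.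
  by apply: h1; apply: le_trans rt; rewrite lerDl ltW.
by apply: h2; apply: le_trans rt; rewrite lerDr ltW.
Qed.

Lemma dual_bounded chi B : tvs_bounded B ->
  exists2 M : K, 0 < M & forall x, B x -> `|ev chi x| <= M.
Proof.
move=> bB.
have U0 : nbhs (0 : E) [set x | `|ev chi x| < 1].
  have : ev chi x @[x --> (0 : E)] --> ev chi 0 by exact: cts_fun.
  rewrite [X in _ --> X](linear0 (chi : 'L(E, K^o))).
  by move/cvgr0_norm_lt; exact.
have [r r0 h] := bB _ U0; exists r => // x Bx.
have rr : r <= `|r| by rewrite gtr0_norm.
have [y /= y1 <-] := h r rr x Bx.
rewrite linearZ /= normrM gtr0_norm//.
by rewrite -[leRHS]mulr1 ler_pM2l// ltW.
Qed.

Lemma strong_ballW chi B1 B2 e1 e2 : B1 `<=` B2 -> e2 <= e1 ->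
  strong_ball chi B2 e2 `<=` strong_ball chi B1 e1.
Proof.
by move=> B12 e21 psi h x B1x; apply: lt_le_trans e21; apply: h; exact: B12.
Qed.

Lemma strong_nbhs_filter chi : ProperFilter (nbhs chi).
Proof.
split.
  move=> [[B e] [/= bB e0]] /(_ chi); apply=> x Bx.
  by rewrite subrr normr0.
apply: filter_from_filter; first by exists (set0, 1) => /=; split => //; exact: tvs_bounded0.
move=> [B1 e1] [B2 e2] /= [b1 e10] [b2 e20].
exists (B1 `|` B2, minr e1 e2) => /=.
  split; first exact: tvs_boundedU.
  by rewrite /minr; case: ifP.
have c12 : e1 >=< e2 by apply: real_comparable; exact: gtr0_real.
move=> psi h; split; apply: (strong_ballW _ _ h).
- exact: subsetUl.
- by rewrite comparable_ge_min// lexx.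
- exact: subsetUr.
- by rewrite comparable_ge_min// lexx orbT.
Qed.

Lemma strong_nbhs_singleton chi (A : set T) : nbhs chi A -> A chi.
Proof.
move=> [[B e] [/= bB e0]]; apply=> x Bx.
by rewrite subrr normr0.
Qed.

Lemma strong_nbhs_nbhs chi (A : set T) :
  nbhs chi A -> nbhs chi (nbhs^~ A).
Proof.
move=> [[B e] [/= bB e0]] BA.
have e20 : 0 < e / 2 by rewrite divr_gt0.
exists (B, e / 2) => //= psi hpsi.
exists (B, e / 2) => //= xi hxi; apply: BA => x Bx.
rewrite (splitr e) -(subrK (ev psi x) (ev xi x)) -addrA.
by rewrite (le_lt_trans (ler_normD _ _))// ltrD//; [exact: hxi|exact: hpsi].
Qed.

HB.instance Definition _ := Nbhs_isNbhsTopological.Build T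
  strong_nbhs_filter strong_nbhs_singleton strong_nbhs_nbhs.

Lemma strong_add_continuous : continuous (fun z : T * T => z.1 + z.2).
Proof.
move=> [chi1 chi2] /= A [[B e] [/= bB e0]] BA.
have e20 : 0 < e / 2 by rewrite divr_gt0.
exists (strong_ball chi1 B (e / 2), strong_ball chi2 B (e / 2)) => /=.
  by split; exists (B, e / 2).
move=> [psi1 psi2] [/= h1 h2]; apply: BA => x Bx.
rewrite (_ : ev (psi1 + psi2) x - ev (chi1 + chi2) x =
  (ev psi1 x - ev chi1 x) + (ev psi2 x - ev chi2 x)); last first.
  by rewrite addrACA -opprD.
rewrite (splitr e) (le_lt_trans (ler_normD _ _))//.
by rewrite ltrD//; [exact: h1|exact: h2].
Qed.

Lemma strong_scale_continuous : continuous (fun z : K^o * T => z.1 *: z.2).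
Proof.
move=> [a chi] /= A [[B e] [/= bB e0]] BA.
have [M M0 hM] := dual_bounded chi bB.
have e20 : 0 < e / 2 by rewrite divr_gt0.
pose d := e / 2 / (`|a| + 1).
have a1 : 0 < `|a| + 1 by rewrite ltr_wpDl.
have d0 : 0 < d by rewrite divr_gt0.
pose c := minr 1 (e / 2 / M).
have c0 : 0 < c by rewrite /c /minr; case: ifP => // _; rewrite divr_gt0.
have cc : (1 : K) >=< e / 2 / M.
  by apply: real_comparable; apply: gtr0_real => //; rewrite divr_gt0.
have c1 : c <= 1 by rewrite comparable_ge_min// lexx.
have cM : c <= e / 2 / M by rewrite comparable_ge_min// lexx orbT.
exists ([set b : K^o | `|a - b| < c], strong_ball chi B d) => /=.
  split; last by exists (B, d).
  by apply/nbhs_ballP; exists c => //= b; rewrite /ball/=.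
move=> [b psi] [/= hb hpsi]; apply: BA => x Bx.
rewrite (_ : ev (b *: psi) x - ev (a *: chi) x =
  b * (ev psi x - ev chi x) + (b - a) * ev chi x); last first.
  by rewrite mulrBr mulrBl addrA subrK.
rewrite (splitr e) (le_lt_trans (ler_normD _ _))// !normrM ltr_leD//.
  have hb1 : `|b| <= `|a| + 1.
    rewrite -[b](subrK a) addrC (le_trans (ler_normD _ _))// lerD2l.
    by rewrite distrC (le_trans (ltW hb)).
  apply: (le_lt_trans (ler_wpM2r (normr_ge0 _) hb1)).
  by rewrite mulrC -ltr_pdivlMr//; exact: hpsi.
rewrite distrC (le_trans (ler_wpM2l (normr_ge0 _) (hM _ Bx)))//.
by rewrite -ler_pdivlMr// (le_trans (ltW hb)).
Qed.

Lemma strong_locally_convex :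
  exists2 B : set_system T, (forall b, b \in B -> convex_set b) & basis B.
Proof.
pose V chi B e : set T :=
  [set psi | exists2 d, 0 < d < e & forall x, B x -> `|ev psi x - ev chi x| <= d].
exists [set A | exists chi B e, [/\ tvs_bounded B, 0 < e & A = V chi B e]].
  move=> A /[!inE] -[chi [B [e [bB e0 ->]]]].
  move=> psi1 psi2 l /[!inE] -[d1 /andP[d10 d1e] h1] [d2 /andP[d20 d2e] h2].
  have c12 : d1 >=< d2 by apply: real_comparable; exact: gtr0_real.
  exists (maxr d1 d2).
    by rewrite comparable_lt_max// d10/= comparable_gt_max// d1e.
  move=> x Bx.
  have l0 : 0 <= l%:num by [].
  have l1 : 0 <= 1 - l%:num by rewrite subr_ge0.
  rewrite -[X in `|X - _|]/(l%:num * ev psi1 x + (1 - l%:num) * ev psi2 x).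
  rewrite (_ : _ - _ = l%:num * (ev psi1 x - ev chi x)
      + (1 - l%:num) * (ev psi2 x - ev chi x)); last first.
    by rewrite !mulrBr addrACA -opprD -mulrDl [_ + (1 - _)]addrC subrK mul1r.
  rewrite (le_trans (ler_normD _ _))// !normrM (ger0_norm l0) (ger0_norm l1).
  rewrite (_ : maxr d1 d2 = l%:num * maxr d1 d2 + (1 - l%:num) * maxr d1 d2).
    apply: lerD; apply: ler_wpM2l => //; rewrite comparable_le_max//.
      by rewrite h1.
    by rewrite h2// orbT.
  by rewrite -mulrDl addrC subrK mul1r.
split.
  move=> A [chi [B [e [bB e0 ->]]]]; rewrite openE => psi [d /andP[d0 de] h].
  have ed0 : 0 < (e - d) / 2 by rewrite divr_gt0// subr_gt0.
  exists (B, (e - d) / 2) => //= xi hxi; exists (d + (e - d) / 2).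
    rewrite addr_gt0//= -ltrBrDl ltr_pdivrMr// mulr_natr mulr2n.
    by rewrite ltrDl subr_gt0.
  move=> x Bx; rewrite -(subrK (ev psi x) (ev xi x)) -addrA [leRHS]addrC.
  rewrite (le_trans (ler_normD _ _))// lerD//; last exact: h.
  by rewrite ltW//; exact: hxi.
move=> chi A [[B e] [/= bB e0]] BA; exists (V chi B e).
  split; first by exists chi, B, e.
  exists (e / 2); last by move=> x Bx; rewrite subrr normr0 ltW// divr_gt0.
  by rewrite divr_gt0//= ltr_pdivrMr// mulr_natr mulr2n ltrDl.
by move=> psi [d /andP[_ de] h]; apply: BA => x Bx; rewrite (le_lt_trans (h _ Bx)).
Qed.

(* This factory only installs the uniform structure. *)
HB.instance Definition _ := PreTopologicalLmod_isTvs.Build K T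
  strong_add_continuous strong_scale_continuous strong_locally_convex.
HB.instance Definition _ :=
  PreTopologicalNmodule_isTopologicalNmodule.Build T strong_add_continuous.
HB.instance Definition _ :=
  TopologicalNmodule_isTopologicalLmodule.Build K T strong_scale_continuous.
HB.instance Definition _ := Uniform_isTvs.Build K T strong_locally_convex.

End strong_dual.

(* Membership in l_p; at p = +oo this is c_0 rather than l_oo. *)
Definition in_lp (R : realType) (p : \bar R) (a : R^nat) : Prop :=
  match p with
  | r%:E => (\sum_(n <oo) (`|a n| `^ r)%:E < +oo)%E
  | +oo%E => a @ \oo --> (0 : R)
  | -oo%E => False
  end.

Definition lp_norm (R : realType) (p : \bar R) (a : R^nat) : R :=
  match p with
  | r%:E => fine (\sum_(n <oo) (`|a n| `^ r)%:E)%E `^ r^-1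
  | _ => sup (range (fun n => `|a n|))
  end.

Section lp_theory.
Context (R : realType).
Implicit Types (a b c : R^nat) (p : \bar R) (r : R).

Local Notation lnorm r a := (Lnorm (@counting nat R) r%:E (EFin \o a)).

Lemma lp_sum_ge0 a r : (0 <= \sum_(n <oo) (`|a n| `^ r)%:E)%E.
Proof. by apply: nneseries_ge0 => n _ _; rewrite lee_fin powR_ge0. Qed.

Lemma Lnorm_lp a r : 0 < r ->
  lnorm r a = ((\sum_(n <oo) (`|a n| `^ r)%:E) `^ r^-1)%E.
Proof. by move=> r0; rewrite Lnorm_counting. Qed.

Lemma in_lpE a r : 0 < r -> in_lp r%:E a <-> (lnorm r a < +oo)%E.
Proof.
move=> r0; rewrite Lnorm_lp//=; split=> [|]; first exact: poweR_lty.
by apply: lty_poweRy; rewrite invr_eq0 gt_eqF.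
Qed.

Lemma lp_normE a r : 0 < r -> lp_norm r%:E a = fine (lnorm r a).
Proof. by move=> r0; rewrite Lnorm_lp// fine_poweR. Qed.

Lemma c0_has_sup a : in_lp +oo%E a -> has_sup (range (fun n => `|a n|)).
Proof.
move=> /= ca; split; first by exists `|a 0%N|, 0%N.
have /cvg_seq_bounded[M [_ /(_ (M + 1))]] : cvgn a by apply/cvg_ex; exists 0.
rewrite ltrDl => /(_ ltr01) h.
by exists (M + 1) => _ [n _ <-]; exact: h.
Qed.

Lemma lp_norm_ge0 p a : 0 <= lp_norm p a.
Proof.
have s0 : 0 <= sup (range (fun n => `|a n|)).
  have [h|h] := pselect (has_ubound (range (fun n => `|a n|))); last first.
    by rewrite sup_out// => -[].
  apply: (@le_trans _ _ `|a 0%N|) => //.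
  by apply: (ub_le_sup h); exists 0%N.
by case: p => [r| |] //=; exact: powR_ge0.
Qed.

Lemma lp_triangle p a b c : (1 <= p)%E ->
  (forall n, `|c n| <= `|a n| + `|b n|) -> in_lp p a -> in_lp p b ->
  in_lp p c /\ lp_norm p c <= lp_norm p a + lp_norm p b.
Proof.
case: p => [r| |] //.
  rewrite lee_fin => r1 cab.
  have r0 : 0 < r by rewrite (lt_le_trans ltr01).
  rewrite !in_lpE// !lp_normE// => aoo boo.
  pose a' n := `|a n|; pose b' n := `|b n|.
  have lnorm_abs (d : R^nat) : lnorm r (fun n => `|d n|) = lnorm r d.
    rewrite !Lnorm_lp//; congr (_ `^ _)%E.
    by apply: eq_eseriesr => n _; rewrite normr_id.
  have cle : (lnorm r c <= lnorm r (a' \+ b')%R)%E.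
    rewrite !Lnorm_lp// gt0_ler_poweR//.
    - by rewrite invr_ge0 ltW.
    - by rewrite in_itv/= lp_sum_ge0 leey.
    - by rewrite in_itv/= lp_sum_ge0 leey.
    apply: lee_nneseries => n *; rewrite lee_fin ?powR_ge0//.
    by rewrite ge0_ler_powR ?nnegrE ?(ltW r0)// (le_trans (cab n))// ler_norm.
  have cab' : (lnorm r c <= lnorm r a + lnorm r b)%E.
    rewrite (le_trans cle)// -(lnorm_abs a) -(lnorm_abs b).
    exact: minkowski_EFin.
  have coo : (lnorm r c < +oo)%E by rewrite (le_lt_trans cab')// lte_add_pinfty.
  split=> //; rewrite -lee_fin EFinD !fineK//;
    by rewrite ge0_fin_numE// Lnorm_ge0.
move=> _ cab ca cb.
have cc : in_lp +oo%E c.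
  have h0 : (fun n => `|a n| + `|b n|) @ \oo --> (0 : R).
    rewrite -[X in _ --> X](addr0 0); apply: cvgD.
      by rewrite -[X in _ --> X](normr0 R); exact: cvg_norm.
    by rewrite -[X in _ --> X](normr0 R); exact: cvg_norm.
  apply: norm_cvg0; apply: (squeeze_cvgr _ (cvg_cst 0) h0).
  by apply: nearW => n; rewrite normr_ge0 cab.
split=> //=; apply: ge_sup; first by exists `|c 0%N|, 0%N.
move=> _ [n _ <-]; rewrite (le_trans (cab n))// lerD//.
  by apply: (ub_le_sup (c0_has_sup ca).2); exists n.
by apply: (ub_le_sup (c0_has_sup cb).2); exists n.
Qed.

Lemma lp_scale p l a c : (1 <= p)%E -> 0 <= l ->
  (forall n, `|c n| = l * `|a n|) -> in_lp p a ->
  in_lp p c /\ lp_norm p c = l * lp_norm p a.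
Proof.
case: p => [r| |] //.
  rewrite lee_fin => r1 l0 cla.
  have r0 : 0 < r by rewrite (lt_le_trans ltr01).
  have sE : (\sum_(n <oo) (`|c n| `^ r)%:E =
      (l `^ r)%:E * \sum_(n <oo) (`|a n| `^ r)%:E)%E.
    rewrite -nneseriesZl; last by move=> n _; rewrite lee_fin powR_ge0.
    by apply: eq_eseriesr => n _; rewrite -EFinM cla powRM.
  move=> /= aoo; split; first by rewrite sE lte_mul_pinfty// lee_fin powR_ge0.
  rewrite sE fineM//; last by rewrite ge0_fin_numE// lp_sum_ge0.
  rewrite powRM ?powR_ge0 ?fine_ge0 ?lp_sum_ge0//.
  by rewrite -powRrM mulfV ?gt_eqF// powRr1.
move=> _ l0 cla /= ca.
have cc : in_lp +oo%E c.
  have h0 : (fun n => l * `|a n|) @ \oo --> (0 : R).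
    rewrite -[X in _ --> X](mulr0 l); apply: cvgMr.
    by rewrite -[X in _ --> X](normr0 R); exact: cvg_norm.
  by apply: norm_cvg0; rewrite (_ : (fun n => `|c n|) = fun n => l * `|a n|) //; apply/funext.
split=> //; apply/le_anti/andP; split.
  apply: ge_sup; first by exists `|c 0%N|, 0%N.
  move=> _ [n _ <-]; rewrite cla ler_wpM2l//.
  by apply: (ub_le_sup (c0_has_sup ca).2); exists n.
have [->|ln0] := eqVneq l 0; first by rewrite mul0r; exact: (lp_norm_ge0 +oo%E).
have lp : 0 < l by rewrite lt_neqAle eq_sym ln0.
rewrite -ler_pdivlMl//; apply: ge_sup; first by exists `|a 0%N|, 0%N.
move=> _ [n _ <-]; rewrite ler_pdivlMl// -cla.
by apply: (ub_le_sup (c0_has_sup cc).2); exists n.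
Qed.

Lemma in_lp0 p : (1 <= p)%E -> in_lp p (fun=> 0 : R).
Proof.
case: p => [r| |] //=; last by move=> _; exact: cvg_cst.
rewrite lee_fin => r1; rewrite eseries0 ?ltry// => n _ _.
by rewrite normr0 powR0// gt_eqF// (lt_le_trans ltr01).
Qed.

Lemma lp_norm_eq0 p a : (1 <= p)%E -> in_lp p a -> lp_norm p a = 0 ->
  forall n, a n = 0.
Proof.
case: p => [r| |] //=.
  rewrite lee_fin => r1 aoo /powR_eq0_eq0 s0 n.
  have r0 : 0 < r by rewrite (lt_le_trans ltr01).
  have : ((`|a n| `^ r)%:E <= \sum_(n <oo) (`|a n| `^ r)%:E)%E.
    have u0 i : (0 <= (`|a i| `^ r)%:E)%E by rewrite lee_fin powR_ge0.
    have := @nneseries_lim_ge R (fun i => (`|a i| `^ r)%:E) xpredT 0%N n.+1.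
    move=> /(_ (fun i _ _ => u0 i)); apply: le_trans.
    by rewrite big_nat_recr//= leeDr//; apply: sume_ge0 => i _; exact: u0.
  rewrite -[leRHS]fineK ?ge0_fin_numE ?lp_sum_ge0// s0 lee_fin => an0.
  by apply/normr0_eq0/(@powR_eq0_eq0 _ _ r)/le_anti; rewrite an0 powR_ge0.
move=> _ ca s0 n; apply/normr0_eq0/le_anti; rewrite normr_ge0 andbT -s0.
by apply: (ub_le_sup (c0_has_sup ca).2); exists n.
Qed.

End lp_theory.

Section lp_space.
Context (R : realType) (k : scalar_kind) (p : \bar R).
Local Notation F := (scalars R k).

Definition lp_pred (p1 : (1 <= p)%E) : {pred nat -> F^o} :=
  mem [set x | in_lp p (fun n => modulus (x n : F))].

(* The Banach space l_p over [scalars R k], and c_0 at p = +oo. *)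
Record lp_space (p1 : (1 <= p)%E) :=
  LpSpace { lp_val :> nat -> F^o ; _ : lp_val \in lp_pred p1 }.

Context (p1 : (1 <= p)%E).

HB.instance Definition _ := [isSub for @lp_val p1].
HB.instance Definition _ := [Choice of lp_space p1 by <:].

Lemma lp_submod_closed : submod_closed (lp_pred p1).
Proof.
split; first by rewrite inE /=; under eq_fun do rewrite modulus0; exact: in_lp0.
move=> a x y; rewrite !inE /= => lx ly.
have lax : in_lp p (fun n => modulus (a * (x n : F))).
  apply: (lp_scale p1 (modulus_ge0 a) _ lx).1 => n.
  by rewrite modulusM normrM (ger0_norm (modulus_ge0 a)).
apply: (lp_triangle p1 _ lax ly).1 => n.
by rewrite !ger0_norm ?modulus_ge0// modulusD.
Qed.

HB.instance Definition _ := GRing.isSubmodClosed.Build _ _ (lp_pred p1)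
  lp_submod_closed.
HB.instance Definition _ := [SubChoice_isSubLmodule of lp_space p1 by <:].

Implicit Types x y : lp_space p1.

Lemma lp_valP x : in_lp p (fun n => modulus (lp_val x n : F)).
Proof. by case: x => x /=; rewrite inE. Qed.

Definition lp_normF x : F :=
  of_real k (lp_norm p (fun n => modulus (lp_val x n : F))).

Lemma lp_normF_triangle x y : lp_normF (x + y) <= lp_normF x + lp_normF y.
Proof.
rewrite -of_realD ler_of_real.
apply: (lp_triangle p1 _ (lp_valP x) (lp_valP y)).2 => n.
by rewrite !ger0_norm ?modulus_ge0// modulusD.
Qed.

Lemma lp_normFZ (l : F) x : lp_normF (l *: x) = `|l| * lp_normF x.
Proof.
rewrite normE -of_realM; congr of_real.
apply: (lp_scale p1 (modulus_ge0 l) _ (lp_valP x)).2 => n.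
by rewrite modulusM normrM (ger0_norm (modulus_ge0 l)).
Qed.

Lemma lp_normF_eq0 x : lp_normF x = 0 -> x = 0.
Proof.
rewrite -(of_real0 R k) => /of_real_inj x0; apply/val_inj/funext => n /=.
by apply/modulus_eq0; exact: (lp_norm_eq0 p1 (lp_valP x) x0).
Qed.

HB.instance Definition _ := Lmodule_isNormed.Build F (lp_space p1)
  lp_normF_triangle lp_normFZ lp_normF_eq0.

End lp_space.

(* Membership in l_p (c_0 at p = +oo) of an extended real sequence; such a
   sequence has only finite terms. *)
Definition in_lpe (R : realType) (p : \bar R) (u : (\bar R)^nat) : Prop :=
  exists2 a : R^nat, in_lp p a & u = EFin \o a.

Section summable_sequences_and_sets.
Context (R : realType) (k : scalar_kind).
Local Notation F := (scalars R k).
Implicit Types (E : tvsType F) (p r s : \bar R).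

Definition weakly_summable E p (x : nat -> E) : Prop :=
  forall chi : dual E, in_lp p (fun n => modulus (chi (x n) : F)).

Definition weakstar_summable E p (chi : nat -> dual E) : Prop :=
  forall x : E, in_lp p (fun n => modulus (chi n x : F)).

Definition sup_on E (A : set E) (chi : dual E) : \bar R :=
  ereal_sup [set (modulus (chi a : F))%:E | a in A].

Definition limited_set E r s (A : set E) : Prop :=
  A !=set0 /\ forall chi : nat -> dual E, weakstar_summable r chi ->
    in_lpe s (fun n => sup_on A (chi n)).

Definition Vstar_set E r s (A : set E) : Prop :=
  A !=set0 /\ forall chi : nat -> strong_dual E, weakly_summable r chi ->
    in_lpe s (fun n => sup_on A (chi n)).

Definition coarse_limited_set E p (p1 : (1 <= p)%E) (A : set E) : Prop :=
  A !=set0 /\ forall S : 'L(E, lp_space k p1), precompact (S @` A).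

End summable_sequences_and_sets.

Section classes_of_operators.
Context (R : realType) (k : scalar_kind).
Local Notation F := (scalars R k).
Context (E L : tvsType F).
Implicit Types (T : {linear E -> L}) (p q r s : \bar R).

Definition weakly_convergent p q T : Prop :=
  forall (eta : nat -> strong_dual L) (x : nat -> E),
    weakly_summable q eta -> weakly_summable p x ->
    (eta n : dual L) (T (x n)) @[n --> \oo] --> (0 : F^o).

Definition weakstar_convergent p q T : Prop :=
  forall (eta : nat -> dual L) (x : nat -> E),
    weakstar_summable q eta -> weakly_summable p x ->
    eta n (T (x n)) @[n --> \oo] --> (0 : F^o).

Definition limited_operator p q T : Prop :=
  exists2 U, nbhs (0 : E) U & limited_set p q (T @` U).

Definition Vstar_operator p q T : Prop :=
  exists2 U, nbhs (0 : E) U & Vstar_set p q (T @` U).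

Definition coarse_limited_operator p (p1 : (1 <= p)%E) T : Prop :=
  exists2 U, nbhs (0 : E) U & coarse_limited_set p1 (T @` U).

Definition limited_convergent r s p T : Prop :=
  forall x : nat -> E, weakly_summable p x -> limited_set r s (range x) ->
    T (x n) @[n --> \oo] --> (0 : L).

Definition Vstar_convergent r s p T : Prop :=
  forall x : nat -> E, weakly_summable p x -> Vstar_set r s (range x) ->
    T (x n) @[n --> \oo] --> (0 : L).

End classes_of_operators.

(* Main.v *)
Require Import Defs.
From HB Require Import structures.
From mathcomp Require Import all_boot all_order all_algebra.
From mathcomp Require Import all_classical all_reals all_analysis.
Import Order.TTheory GRing.Theory Num.Def Num.Theory.
Import numFieldNormedType.Exports.
Local Open Scope classical_set_scope.
Local Open Scope ring_scope.

(** Each of the seven classes is defined by testing an operator against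
    sequences of functionals, sequences of vectors or operators into a sequence
    space, and each of these testing objects is transported along continuous
    linear maps.

    Vectors are pushed forward: [weakly_summable_image].  Functionals are pulled
    back, [chi] on [L] becoming [chi \o f] on [E].  For weak-star summable
    sequences this is immediate.  For sequences weakly summable in the strong
    dual it says that the adjoint of [f] is continuous from the strong dual of
    [L] to that of [E] ([adjoint_continuous_linear]), so that it is a case of
    the push-forward of vectors; the continuity holds because [f] maps bounded
    sets to bounded sets.  Both kinds of sequences are treated together through
    the notion [pullback_stable], which settles the weakly and the weak-star
    convergent operators: a composite [V \o T \o Q] tested on [eta] and [x] is [T] tested on
    [eta \o V] and [Q \o x], and linear combinations are handled by linearity
    of [eta n].

    The remaining classes are given by a family of small sets, namely limited,
    V-star or coarse limited sets.  Each family is a [set_ideal]: it is stable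
    under continuous linear images, non-empty subsets and the operation
    sending [X] and [Y] to [a X + b Y].  For the first two this is an estimate
    of suprema ([uniformly_summable_ideal]); for the third, [a X + b Y] lies in
    the image of a compact product under a continuous map
    ([precompact_lincomb]).  If [T] maps a neighbourhood [U] of zero to a small
    set, then [V \o T \o Q] maps [Q @^-1` U] into [V (T U)]; if [S] does the
    same with [W], then [a T + b S] maps [U `&` W] into [a T(U) + b S(W)].
    For the operators that send small weakly summable sequences to null
    sequences, [Q] maps small sequences to small ones, and the limits
    pass through [V] and through linear combinations by continuity. *)

(** * Continuous linear maps *)

Section composition.
Context {K : numFieldType} {E L M : tvsType K}.

Lemma comp_continuous_linear (g : 'L(L, M)) (f : 'L(E, L)) :
  (g \o f : E -> M) \in @continuous_linear K E M.
Proof.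
rewrite inE; split; first by move=> a x y /=; rewrite linearP linearP.
by move=> x; apply: continuous_comp; exact: cts_fun.
Qed.

Definition compCL (g : 'L(L, M)) (f : 'L(E, L)) : 'L(E, M) :=
  continuous_linear_Sub (comp_continuous_linear g f).

End composition.

Lemma cvg_linear0 {K : numFieldType} {E L : tvsType K} (f : 'L(E, L)) :
  f x @[x --> (0 : E)] --> (0 : L).
Proof.
have : f x @[x --> (0 : E)] --> f 0 by exact: cts_fun.
by rewrite [X in _ --> X](linear0 f).
Qed.

Lemma lincomb_continuous {K : numFieldType} {L : tvsType K} (a b : K) :
  continuous (fun z : L * L => a *: z.1 + b *: z.2).
Proof.
have scale_cvg (c : K) (x : L) : c *: y @[y --> x] --> c *: x.
  apply: (@continuous_comp L (K^o * L)%type L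
    (fun y => (c, y)) (fun z => z.1 *: z.2)); last exact: scale_continuous.
  by apply: (@cvg_pair _ _ _ _ (nbhs (c : K^o))); [exact: cvg_cst|exact: cvg_id].
move=> z; apply: (@continuous_comp (L * L)%type (L * L)%type L
  (fun z => (a *: z.1, b *: z.2)) (fun z => z.1 + z.2)); last exact: add_continuous.
apply: cvg_pair.
- by apply: (@cvg_comp _ _ _ fst (fun y => a *: y)); [exact: cvg_fst|exact: scale_cvg].
- by apply: (@cvg_comp _ _ _ snd (fun y => b *: y)); [exact: cvg_snd|exact: scale_cvg].
Qed.

Lemma cvg_lincomb0 {K : numFieldType} {L : tvsType K} (a b : K) (x y : nat -> L) :
  x n @[n --> \oo] --> (0 : L) -> y n @[n --> \oo] --> (0 : L) ->
  a *: x n + b *: y n @[n --> \oo] --> (0 : L).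
Proof.
move=> x0 y0.
have := @lincomb_continuous K L a b (0, 0).
rewrite /continuous_at /= !scaler0 addr0.
exact: cvg_comp (cvg_pair x0 y0).
Qed.

(** * The adjoint between strong duals *)

Section adjoint.
Context {K : numFieldType} {E L : tvsType K}.
Implicit Types (f : 'L(E, L)).

(** If [B] is absorbed by the neighbourhood [f @^-1` U], then its image is
    absorbed by [U] with the same scalars. *)
Lemma tvs_bounded_image f (B : set E) : tvs_bounded B -> tvs_bounded (f @` B).
Proof.
move=> bB U U0; have [r r0 h] := bB _ (cvg_linear0 f _ U0).
exists r => // t rt _ [x Bx <-].
by have [y Uy <-] := h t rt x Bx; exists (f y); rewrite ?linearZ.
Qed.

Definition adjoint f (chi : strong_dual L) : strong_dual E :=
  compCL (chi : dual L) f.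

(** Being [e]-close on the bounded set [f @` B] is being [e]-close on [B] after
    composition with [f]. *)
Lemma adjoint_continuous_linear f :
  adjoint f \in @continuous_linear K (strong_dual L) (strong_dual E).
Proof.
rewrite inE; split; first by move=> a chi psi; apply/val_inj.
move=> chi A [[B e] [/= bB e0] BA].
exists (f @` B, e) => /=; first by split => //; exact: tvs_bounded_image.
by move=> psi h; apply: BA => x Bx; apply: h; exists x.
Qed.

Definition adjointCL f : 'L(strong_dual L, strong_dual E) :=
  continuous_linear_Sub (adjoint_continuous_linear f).

End adjoint.

(** * Transport of summable sequences *)

Section stability.
Context {R : realType} {k : scalar_kind}.
Local Notation F := (scalars R k).

(** [C E] is a class of sequences of functionals, meant to be the weak-star
    summable ones or those that are weakly summable in the strong dual. *)
Definition pullback_stable (C : forall E : tvsType F, set (nat -> dual E)) :=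
  forall (E L : tvsType F) (f : 'L(E, L)) (chi : nat -> dual L),
    C L chi -> C E (fun n => compCL (chi n) f).

Lemma weakstar_summable_pullback (r : \bar R) :
  pullback_stable (fun E => @weakstar_summable R k E r).
Proof. by move=> E L f chi hchi x; exact: hchi. Qed.

Lemma weakly_summable_image {E L : tvsType F} {r : \bar R} (f : 'L(E, L))
    {x : nat -> E} :
  weakly_summable r x -> weakly_summable r (f \o x).
Proof. by move=> hx chi; exact: (hx (compCL chi f)). Qed.

(** The image of a sequence under the adjoint operator, seen as a sequence of
    vectors of the strong dual. *)
Lemma weakly_summable_pullback (r : \bar R) :
  pullback_stable (fun E => @weakly_summable R k (strong_dual E) r).
Proof. by move=> E L f chi; exact: (weakly_summable_image (adjointCL f)). Qed.

(** * Ideals of small sets *)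

(** The properties of a family of small sets that make the operators mapping a
    neighbourhood of zero to a small set stable under composition and linear
    combinations. *)
Record set_ideal (A : forall E : tvsType F, set (set E)) : Prop := SetIdeal {
  ideal_image : forall (E L : tvsType F) (f : 'L(E, L)) X,
    A E X -> A L (f @` X) ;
  ideal_subset : forall (E : tvsType F) (X Y : set E),
    X !=set0 -> X `<=` Y -> A E Y -> A E X ;
  ideal_lincomb : forall (E : tvsType F) (a b : F) (X Y : set E),
    A E X -> A E Y ->
    A E [set a *: z.1 + b *: z.2 | z in X `*` Y] }.
Arguments ideal_image {A} _ {E L} f {X}.
Arguments ideal_subset {A} _ {E X Y}.
Arguments ideal_lincomb {A} _ {E} a b {X Y}.

Section uniform_summability.
Context {C : forall E : tvsType F, set (nat -> dual E)} (hC : pullback_stable C).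
Context {s : \bar R} (s1 : (1 <= s)%E).

(** The common form of limited and V-star sets, according to the class [C]. *)
Definition uniformly_summable {E : tvsType F} (A : set E) : Prop :=
  A !=set0 /\ forall chi : nat -> dual E, C E chi ->
    in_lpe s (fun n => sup_on A (chi n)).

(** Solidity of the sequence space; domination by a real sequence also yields
    the finiteness of the terms that [in_lpe] requires. *)
Lemma in_lpe_le {u : (\bar R)^nat} {v : R^nat} :
  (forall n, (0 <= u n <= (v n)%:E)%E) -> in_lp s v -> in_lpe s u.
Proof.
move=> huv hv.
have uE n : u n = (fine (u n))%:E.
  have /andP[u0 uv] := huv n.
  by rewrite fineK// ge0_fin_numE// (le_lt_trans uv)// ltry.
exists (fine \o u); last by apply/funext => n /=; exact: uE.
apply: (lp_triangle s1 _ hv (in_lp0 s1)).1 => n.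
have := huv n; rewrite uE !lee_fin normr0 addr0 /= => /andP[u0 uv].
by rewrite ger0_norm// (le_trans uv)// ler_norm.
Qed.

Lemma sup_on_ge0 {E : tvsType F} {A : set E} (chi : dual E) :
  A !=set0 -> (0 <= sup_on A chi)%E.
Proof.
move=> [x Ax]; apply: (@le_trans _ _ (modulus (chi x : F))%:E).
  by rewrite lee_fin modulus_ge0.
by apply: ereal_sup_ubound; exists x.
Qed.

(** The supremum of [chi n] over [f @` A] is that of [chi n \o f] over [A]. *)
Lemma uniformly_summable_image (E L : tvsType F) (f : 'L(E, L)) (A : set E) :
  uniformly_summable A -> uniformly_summable (f @` A).
Proof.
move=> [[x Ax] h]; split; first by exists (f x), x.
move=> chi hchi; have := h _ (hC _ _ f _ hchi).
by congr in_lpe; apply/funext => n; rewrite /sup_on image_comp.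
Qed.

Lemma uniformly_summable_subset (E : tvsType F) (A B : set E) :
  A !=set0 -> A `<=` B -> uniformly_summable B -> uniformly_summable A.
Proof.
move=> A0 AB [_ h]; split => // chi /h[v hv vE].
apply: (in_lpe_le _ hv) => n; rewrite sup_on_ge0//=.
rewrite -[leRHS]/((EFin \o v) n) -vE.
by apply: ereal_sup_le; exact: image_subset.
Qed.

(** The supremum over [a A + b B] is at most [|a|] times the supremum over [A]
    plus [|b|] times the supremum over [B], and the sequence space is closed
    under linear combinations. *)
Lemma uniformly_summable_lincomb (E : tvsType F) (a b : F) (A B : set E) :
  uniformly_summable A -> uniformly_summable B ->
  uniformly_summable [set a *: z.1 + b *: z.2 | z in A `*` B].
Proof.
move=> [[x0 Ax0] hA] [[y0 By0] hB].
have D0 : [set a *: z.1 + b *: z.2 | z in A `*` B] !=set0.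
  by exists (a *: x0 + b *: y0), (x0, y0).
split=> // chi hchi.
have [u hu uE] := hA _ hchi; have [v hv vE] := hB _ hchi.
have scaled (c : F) w : in_lp s w -> in_lp s (fun n => modulus c * w n).
  move=> hw; apply: (lp_scale s1 (modulus_ge0 c) _ hw).1 => n.
  by rewrite normrM (ger0_norm (modulus_ge0 c)).
have huv : in_lp s (fun n => modulus a * u n + modulus b * v n).
  apply: (lp_triangle s1 _ (scaled a _ hu) (scaled b _ hv)).1 => n.
  exact: ler_normD.
apply: (in_lpe_le _ huv) => n; rewrite sup_on_ge0//=.
apply: ge_ereal_sup => _ [_ [[x y] [/= Ax By] <-] <-]; rewrite lee_fin.
rewrite linearD !linearZ /= (le_trans (modulusD _ _))// !modulusM.
apply: lerD; apply: ler_wpM2l; rewrite ?modulus_ge0// -lee_fin.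
- rewrite -[leRHS]/((EFin \o u) n) -uE.
  by apply: ereal_sup_ubound; exists x.
- rewrite -[leRHS]/((EFin \o v) n) -vE.
  by apply: ereal_sup_ubound; exists y.
Qed.

Lemma uniformly_summable_ideal : set_ideal (@uniformly_summable).
Proof.
split.
- exact: uniformly_summable_image.
- exact: uniformly_summable_subset.
- exact: uniformly_summable_lincomb.
Qed.

End uniform_summability.

Lemma limited_set_ideal {r s : \bar R} : (1 <= s)%E ->
  set_ideal (fun E => @limited_set R k E r s).
Proof. move=> s1; exact (uniformly_summable_ideal (weakstar_summable_pullback r) s1). Qed.

Lemma Vstar_set_ideal {r s : \bar R} : (1 <= s)%E ->
  set_ideal (fun E => @Vstar_set R k E r s).
Proof. move=> s1; exact (uniformly_summable_ideal (weakly_summable_pullback r) s1). Qed.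

(** The continuous image of [closure X `*` closure Y] is compact, and closed
    because the space is Hausdorff, so it contains the closure of the set. *)
Lemma precompact_lincomb {L : tvsType F} (a b : F) {X Y : set L} :
  hausdorff_space L -> precompact X -> precompact Y ->
  precompact [set a *: z.1 + b *: z.2 | z in X `*` Y].
Proof.
move=> hL; rewrite !precompactE => cX cY.
set f := fun z : L * L => a *: z.1 + b *: z.2.
have cf : compact (f @` (closure X `*` closure Y)).
  apply: continuous_compact; last exact: compact_setX.
  by apply: continuous_subspaceT; exact: lincomb_continuous.
apply: (subclosed_compact _ cf); first exact: closed_closure.
have /closure_id -> := compact_closed hL cf.
apply: closureS; apply: image_subset => z [Xz Yz].
by split; exact: subset_closure.
Qed.

Lemma coarse_limited_set_ideal {p : \bar R} (p1 : (1 <= p)%E) :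
  set_ideal (fun E => @coarse_limited_set R k E p p1).
Proof.
split.
- move=> E L f X [[x Xx] h]; split; first by exists (f x), x.
  by move=> S; have := h (compCL S f); rewrite image_comp.
- move=> E X Y X0 XY [_ h]; split=> // S.
  by apply: (precompact_subset _ (h S)); exact: image_subset.
- move=> E a b X Y [[x Xx] hX] [[y Yy] hY]; split.
    by exists (a *: x + b *: y), (x, y).
  move=> S; have hlp := @norm_hausdorff _ (lp_space k p1).
  have := precompact_lincomb a b hlp (hX S) (hY S).
  apply: precompact_subset.
  move=> _ [_ [[u v] [/= Xu Yv] <-] <-]; exists (S u, S v).
    by split; [exists u|exists v].
  by rewrite /= linearD !linearZ.
Qed.

(** * Operators *)

Section operators.
Context {E0 E L L0 : tvsType F}.
Context (Q : 'L(E0, E)) (T S : 'L(E, L)) (V : 'L(L, L0)) (a b : F).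

Section ideal_operators.
Context {A : forall E : tvsType F, set (set E)} (hA : set_ideal A).

(** Take [Q @^-1` U] as the neighbourhood of zero. *)
Lemma ideal_operator_comp :
  (exists2 U, nbhs (0 : E) U & A L (T @` U)) ->
  exists2 U, nbhs (0 : E0) U & A L0 ((V \o T \o Q) @` U).
Proof.
move=> [U U0 AU]; exists (Q @^-1` U); first exact: cvg_linear0 Q _ U0.
apply: (ideal_subset hA) (ideal_image hA V AU).
  exists (V (T (Q 0))), 0 => //=.
  by rewrite linear0; exact: nbhs_singleton.
by move=> _ [x Ux <-]; exists (T (Q x)) => //; exists (Q x).
Qed.

(** Take the intersection of the two neighbourhoods; its image lies in
    [a T(U) + b S(W)], where the two points of [U] and [W] coincide. *)
Lemma ideal_operator_lincomb :
  (exists2 U, nbhs (0 : E) U & A L (T @` U)) ->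
  (exists2 U, nbhs (0 : E) U & A L (S @` U)) ->
  exists2 U, nbhs (0 : E) U & A L ((a *: T + b *: S) @` U).
Proof.
move=> [U U0 AU] [W W0 AW]; exists (U `&` W); first exact: filterI.
apply: (ideal_subset hA) (ideal_lincomb hA a b AU AW).
  by exists ((a *: T + b *: S) 0), 0 => //; split; exact: nbhs_singleton.
move=> _ [x [Ux Wx] <-]; exists (T x, S x) => //.
by split; exists x.
Qed.

Lemma ideal_convergent_comp {p : \bar R} :
  (forall x : nat -> E, weakly_summable p x -> A E (range x) ->
    T (x n) @[n --> \oo] --> (0 : L)) ->
  forall x : nat -> E0, weakly_summable p x -> A E0 (range x) ->
    V (T (Q (x n))) @[n --> \oo] --> (0 : L0).
Proof.
move=> hT x hx Ax.
have := ideal_image hA Q Ax; rewrite image_comp => AQ.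
have TQx0 := hT _ (weakly_summable_image Q hx) AQ.
exact: (cvg_comp (T \o Q \o x) V TQx0 (cvg_linear0 V)).
Qed.

End ideal_operators.

Lemma convergent_comp {C : forall E : tvsType F, set (nat -> dual E)}
    (hC : pullback_stable C) {p : \bar R} :
  (forall (eta : nat -> dual L) (x : nat -> E), C L eta -> weakly_summable p x ->
    eta n (T (x n)) @[n --> \oo] --> (0 : F^o)) ->
  forall (eta : nat -> dual L0) (x : nat -> E0),
    C L0 eta -> weakly_summable p x ->
    eta n (V (T (Q (x n)))) @[n --> \oo] --> (0 : F^o).
Proof.
move=> hT eta x heta hx.
exact: hT (hC _ _ V _ heta) (weakly_summable_image Q hx).
Qed.

Lemma cvg_eval_lincomb (eta : nat -> dual L) (x : nat -> E) :
  eta n (T (x n)) @[n --> \oo] --> (0 : F^o) ->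
  eta n (S (x n)) @[n --> \oo] --> (0 : F^o) ->
  eta n ((a *: T + b *: S) (x n)) @[n --> \oo] --> (0 : F^o).
Proof.
move=> hT hS; under eq_fun do rewrite linearD !linearZ.
exact: cvg_lincomb0.
Qed.

End operators.
End stability.

(** * The stability theorem *)

Theorem proposition3p6 (R : realType) (k : scalar_kind) (p q q' : \bar R)
    (p1 : (1 <= p)%E) (q1 : (1 <= q)%E) (q'1 : (1 <= q')%E) (q'q : (q' <= q)%E)
    (lambda mu : scalars R k) (E0 E L L0 : tvsType (scalars R k))
    (hE0 : hausdorff_space E0) (hE : hausdorff_space E)
    (hL : hausdorff_space L) (hL0 : hausdorff_space L0)
    (Q : 'L(E0, E)) (T S : 'L(E, L)) (V : 'L(L, L0)) :
  (weakly_convergent p q T -> weakly_convergent p q S ->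
     weakly_convergent p q (V \o T \o Q) /\
     weakly_convergent p q (lambda *: T + mu *: S)) /\
  (weakstar_convergent p q T -> weakstar_convergent p q S ->
     weakstar_convergent p q (V \o T \o Q) /\
     weakstar_convergent p q (lambda *: T + mu *: S)) /\
  ((p <= q)%E -> limited_operator p q T -> limited_operator p q S ->
     limited_operator p q (V \o T \o Q) /\
     limited_operator p q (lambda *: T + mu *: S)) /\
  ((p <= q)%E -> Vstar_operator p q T -> Vstar_operator p q S ->
     Vstar_operator p q (V \o T \o Q) /\
     Vstar_operator p q (lambda *: T + mu *: S)) /\
  (limited_convergent q' q p T -> limited_convergent q' q p S ->
     limited_convergent q' q p (V \o T \o Q) /\
     limited_convergent q' q p (lambda *: T + mu *: S)) /\
  (Vstar_convergent q' q p T -> Vstar_convergent q' q p S ->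
     Vstar_convergent q' q p (V \o T \o Q) /\
     Vstar_convergent q' q p (lambda *: T + mu *: S)) /\
  (coarse_limited_operator p1 T -> coarse_limited_operator p1 S ->
     coarse_limited_operator p1 (V \o T \o Q) /\
     coarse_limited_operator p1 (lambda *: T + mu *: S)).
Proof.
split.
  move=> hT hS; split; first exact (convergent_comp Q T V (weakly_summable_pullback q) hT).
  move=> eta x heta hx.
  exact: cvg_eval_lincomb (hT _ _ heta hx) (hS _ _ heta hx).
split.
  move=> hT hS; split; first exact (convergent_comp Q T V (weakstar_summable_pullback q) hT).
  move=> eta x heta hx.
  exact: cvg_eval_lincomb (hT _ _ heta hx) (hS _ _ heta hx).
split.
  move=> _ hT hS; have idl := limited_set_ideal (k := k) (r := p) q1.
  split; first exact (ideal_operator_comp Q T V idl hT).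
  exact (ideal_operator_lincomb T S lambda mu idl hT hS).
split.
  move=> _ hT hS; have idl := Vstar_set_ideal (k := k) (r := p) q1.
  split; first exact (ideal_operator_comp Q T V idl hT).
  exact (ideal_operator_lincomb T S lambda mu idl hT hS).
split.
  move=> hT hS; have idl := limited_set_ideal (k := k) (r := q') q1.
  split; first exact (ideal_convergent_comp Q T V idl hT).
  by move=> x hx Ax; exact: cvg_lincomb0 (hT x hx Ax) (hS x hx Ax).
split.
  move=> hT hS; have idl := Vstar_set_ideal (k := k) (r := q') q1.
  split; first exact (ideal_convergent_comp Q T V idl hT).
  by move=> x hx Ax; exact: cvg_lincomb0 (hT x hx Ax) (hS x hx Ax).
move=> hT hS; have idl := coarse_limited_set_ideal (k := k) p1.
split; first exact (ideal_operator_comp Q T V idl hT).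
exact (ideal_operator_lincomb T S lambda mu idl hT hS).
Qed.
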